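(* Let $k \ge 1$ be an integer and let $G$ be a connected $k$-SI graph with at least two vertices, of order $n(G)$, size $m(G)$, and maximum degree $\Delta(G)$. Then $$m(G) \le \frac{n(G)\,\Delta(G)\,(\Delta(G)-k)}{2\Delta(G)-k},$$ and equality holds if and only if $C_d(G) = 2$.
   Context: Graphs are finite and simple. For a positive integer $k$, a graph $G$ is a $k$-stepwise irregular graph ($k$-SI graph) if $|d_G(u) - d_G(v)| = k$ for every edge $uv \in E(G)$, where $d_G(x)$ is the degree of $x$ in $G$. The order $n(G)$ is the number of vertices and the size $m(G)$ is the number of edges. The degree complexity $C_d(G)$ is the number of distinct vertex degrees occurring in $G$. *)

(* Defs.v *)
From mathcomp Require Import all_boot all_order all_algebra.

Set Implicit Arguments.
Unset Strict Implicit.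
Unset Printing Implicit Defensive.

Import Order.TTheory GRing.Theory Num.Theory.

Record sgraph : Type := SGraph {
  vertex :> finType;
  adj : rel vertex;
  adj_sym : symmetric adj;
  adj_irr : irreflexive adj
}.

Definition edges (G : sgraph) : {set {set G}} :=
  [set [set x; y] | x in G, y in G & adj x y].

Definition gorder (G : sgraph) : nat := #|G|.

Definition gsize (G : sgraph) : nat := #|edges G|.

Definition deg (G : sgraph) (x : G) : nat := #|[set y | adj x y]|.

Definition max_deg (G : sgraph) : nat := \max_(x : G) deg x.

(* The empty graph also satisfies this predicate. *)
Definition connected (G : sgraph) : Prop :=
  forall x y : G, connect (@adj G) x y.

(* The difference is taken in int, since subtraction on nat is truncated. *)
Definition stepwise_irregular (k : nat) (G : sgraph) : Prop :=
  forall u v : G, adj u v ->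
    (`|(deg u)%:Z - (deg v)%:Z| = k%:Z)%R.

Definition degree_complexity (G : sgraph) : nat :=
  size (undup [seq deg x | x : G]).

(* Main.v *)
(** Summing [1 / deg u + 1 / deg v] over all edges [uv] gives the order of [G].
    On an edge the two degrees are [a] and [a + k] with [a + k <= D], where [D]
    is the maximum degree, so each term is at least [1 / (D - k) + 1 / D], with
    equality iff the larger degree is [D]. Equality on all edges means that only
    the degrees [D - k] and [D] occur. *)
Require Import Defs.
From mathcomp Require Import all_boot all_order all_algebra.
From mathcomp Require Import zify ring.
Import Order.TTheory GRing.Theory Num.Theory.
Local Open Scope ring_scope.

Definition arcs (G : sgraph) : {set G * G} := [set p | adj p.1 p.2].

(** Forgetting orientation maps the arcs onto the edges. The fibre over an edge consists of its two
    orientations, which differ because no vertex is adjacent to itself. *)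
Lemma card_arcs (G : sgraph) : #|arcs G| = (gsize G * 2)%N.
Proof.
pose f (p : G * G) := [set p.1; p.2].
have edgesE : edges G = f @: arcs G.
  apply/setP => e; apply/imset2P/imsetP.
    move=> [x y _]; rewrite inE => /andP[_ xy] ->.
    by exists (x, y); rewrite ?inE.
  by move=> [[x y]]; rewrite inE /= => xy ->; exists x y; rewrite ?inE.
rewrite -sum1_card (partition_big_imset f) -edgesE /=.
rewrite (eq_bigr (fun=> 2%N)) ?sum_nat_const // => e.
rewrite edgesE => /imsetP[[x y]]; rewrite inE /= => xy ->{e}.
have nxy : x != y by apply/eqP => exy; move: xy; rewrite exy adj_irr.
rewrite sum1dep_card -(_ : #|[set (x, y); (y, x)]| = 2%N); last first.
  by rewrite cards2 xpair_eqE (negbTE nxy).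
apply: eq_card => -[a b]; rewrite !inE /f !xpair_eqE /=.
apply/andP/orP => [[ab /eqP E] | []/andP[/eqP-> /eqP->]]; last 2 first.
- by [].
- by rewrite adj_sym setUC.
have nab : a != b by apply/eqP => eab; move: ab; rewrite eab adj_irr.
have: a \in [set x; y] by rewrite -E !inE eqxx.
have: b \in [set x; y] by rewrite -E !inE eqxx orbT.
rewrite !inE => /orP[]/eqP eb /orP[]/eqP ea; move: nab; rewrite ea eb ?eqxx //.
  by right.
by left.
Qed.

Lemma sum_arcs_fst (G : sgraph) (F : G -> rat) :
  \sum_(p in arcs G) F p.1 = \sum_x F x * (deg x)%:R.
Proof.
transitivity (\sum_x \sum_(y | adj x y) F x).
  by rewrite pair_big_dep; apply: eq_bigl => p; rewrite [LHS]inE.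
by apply: eq_bigr => x _; rewrite sumr_const mulr_natr /deg cardsE.
Qed.

Lemma sum_arcs_snd (G : sgraph) (F : G -> rat) :
  \sum_(p in arcs G) F p.2 = \sum_(p in arcs G) F p.1.
Proof.
have swap_inj : injective (fun p : G * G => (p.2, p.1)).
  by move=> [a b] [c d] [-> ->].
rewrite (reindex_inj swap_inj) /=.
by apply: eq_bigl => p; rewrite !inE /= adj_sym.
Qed.

(** A vertex [x] is the first end of [deg x] arcs and the second end of as many, so it contributes
    [deg x / deg x = 1] on each side. Positivity matters, as the inverse of 0 is 0 here. *)
Lemma sum_arcs_inv_deg (G : sgraph) :
  (forall x : G, 0 < deg x)%N ->
  \sum_(p in arcs G) ((deg p.1)%:R^-1 + (deg p.2)%:R^-1) =
  2%:R * (gorder G)%:R :> rat.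
Proof.
move=> deg_gt0; rewrite big_split /=.
rewrite (sum_arcs_snd _ (fun x => (deg x)%:R^-1)).
rewrite (sum_arcs_fst _ (fun x => (deg x)%:R^-1)).
rewrite (eq_bigr (fun=> 1)); last first.
  by move=> x _; rewrite mulVf // pnatr_eq0 -lt0n.
by rewrite sumr_const mulr_natl mulr2n.
Qed.

Lemma leif_natrV (a b : nat) : (0 < a)%N -> (a <= b)%N ->
  (b%:R^-1 : rat) <= a%:R^-1 ?= iff (a == b).
Proof.
move=> a0 ab; split; last by rewrite (inj_eq invr_inj) eqr_nat eq_sym.
by rewrite lef_pV2 ?posrE ?ltr0n ?ler_nat ?(leq_trans a0).
Qed.

Lemma inv_sum_leif (k D a b : nat) : (0 < a)%N -> (0 < b)%N ->
  (a <= D)%N -> (b <= D)%N -> a = (b + k)%N \/ b = (a + k)%N ->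
  ((D - k)%N%:R^-1 + D%:R^-1 : rat) <= a%:R^-1 + b%:R^-1
    ?= iff (maxn a b == D).
Proof.
move=> a0 b0 aD bD.
wlog ba : a b a0 b0 aD bD / b = (a + k)%N => [H [] E|_].
- by rewrite maxnC [X in _ <= X ?= iff _]addrC; apply: H; auto.
- by apply: H; auto.
(* As [b = a + k], the bounds [a <= D - k] and [b <= D] are tight together, so they can be inverted
   and added separately. *)
have -> : (maxn a b == D) = (a == (D - k)%N) && (b == D)%N by lia.
by apply: leifD; apply: leif_natrV; lia.
Qed.

Section StepwiseIrregular.

Variables (k : nat) (G : sgraph).
Hypothesis G_SI : stepwise_irregular k G.

Let D := max_deg G.

Lemma deg_le_max (x : G) : (deg x <= D)%N.
Proof. exact: leq_bigmax. Qed.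

Lemma stepwise_deg (x y : G) : adj x y ->
  deg x = (deg y + k)%N \/ deg y = (deg x + k)%N.
Proof. by move=> /G_SI; lia. Qed.

Hypothesis deg_gt0 : forall x : G, (0 < deg x)%N.

Lemma ex_adj (x : G) : exists y, adj x y.
Proof. by have /card_gt0P[y] := deg_gt0 x; rewrite inE; exists y. Qed.

Hypothesis G_ne : (0 < gorder G)%N.

(** Take a vertex of degree [D] and any neighbour: its degree differs from [D] by [k] and cannot
    exceed [D]. *)
Lemma ex_max_arc : exists x y : G,
  [/\ adj x y, deg x = D & deg y = (D - k)%N].
Proof.
have [x Dx] := bigop.eq_bigmax (@deg G) G_ne.
have [y xy] := ex_adj x.
exists x, y; split=> //; have := stepwise_deg _ _ xy.
by have := deg_le_max y; rewrite /D /max_deg Dx; lia.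
Qed.

Lemma max_deg_gt : (k < D)%N.
Proof. by have [x [y [_ _ Ey]]] := ex_max_arc; have := deg_gt0 y; lia. Qed.

Hypothesis k_gt0 : (0 < k)%N.

(** The degrees [D] and [D - k] always occur, so complexity 2 means that there are no others. Every
    vertex lies on an arc, and the ends of an arc have distinct degrees as [k > 0]. *)
Lemma degree_complexity_eq2 :
  [forall (p | p \in arcs G), maxn (deg p.1) (deg p.2) == D] <->
  degree_complexity G = 2%N.
Proof.
have kD := max_deg_gt.
have [x0 [y0 [_ Ex0 Ey0]]] := ex_max_arc.
have uD : uniq [:: D; (D - k)%N] by rewrite /= inE; lia.
have sD : {subset [:: D; (D - k)%N] <= undup [seq deg x | x : G]}.
  move=> d; rewrite mem_undup !inE => /orP[]/eqP->.
    by rewrite -Ex0; apply: image_f.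
  by rewrite -Ey0; apply: image_f.
split=> [/forall_inP maxD | C2]; last apply/forall_inP.
  suff /perm_size : perm_eq (undup [seq deg x | x : G]) [:: D; (D - k)%N] by [].
  apply: uniq_perm => //; first exact: undup_uniq.
  move=> d; apply/idP/idP; last exact: sD.
  rewrite mem_undup => /imageP[x _ ->{d}].
  have [y xy] := ex_adj x.
  have := maxD (x, y); rewrite !inE /= => /(_ xy).
  by have := stepwise_deg _ _ xy; lia.
move=> [x y]; rewrite inE /= => xy.
(* Two distinct degrees inside a list of length 2 exhaust it. *)
have [_ degE] := uniq_min_size uD sD (eq_leq C2).
have degP (z : G) : (deg z == D) || (deg z == (D - k)%N).
  by have := degE (deg z); rewrite mem_undup image_f // !inE.
by have := degP x; have := degP y; have := stepwise_deg _ _ xy; lia.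
Qed.

End StepwiseIrregular.

(** The first step of a path from [x] to some other vertex gives a neighbour of [x]. *)
Lemma connected_deg_gt0 (G : sgraph) : connected G -> (1 < gorder G)%N ->
  forall x : G, (0 < deg x)%N.
Proof.
move=> G_conn /card_gt1P[a [b [_ _ ab]]] x.
have [z xz] : exists z, z != x.
  have [ax|] := eqVneq a x; last by exists a.
  by exists b; rewrite eq_sym -ax.
have /connectP[[|y p] /=] := G_conn x z.
  by move=> _ zx; rewrite zx eqxx in xz.
by move=> /andP[xy _] _; apply/card_gt0P; exists y; rewrite inE.
Qed.

Theorem theorem5p1 (k : nat) (G : sgraph)
    (k_ge1 : (1 <= k)%N)
    (G_conn : connected G)
    (G_SI : stepwise_irregular k G)
    (n_ge2 : (2 <= gorder G)%N) :
  let n : rat := (gorder G)%:R in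
  let m : rat := (gsize G)%:R in
  let D : rat := (max_deg G)%:R in
  m <= n * D * (D - k%:R) / (2%:R * D - k%:R)
  /\ (m = n * D * (D - k%:R) / (2%:R * D - k%:R)
      <-> degree_complexity G = 2%N).
Proof.
move=> n m D.
have dgt0 := connected_deg_gt0 G G_conn n_ge2.
have n_gt0 := ltnW n_ge2.
have kD := max_deg_gt _ _ G_SI dgt0 n_gt0.
(* [c] is the least possible contribution of an edge, and the claimed bound on [m] is [n / c]. *)
pose c : rat := (max_deg G - k)%N%:R^-1 + D^-1.
have D0 : 0 < D by rewrite ltr0n; lia.
have Dk0 : 0 < D - k%:R by rewrite subr_gt0 ltr_nat.
have D2k0 : 0 < 2%:R * D - k%:R.
  by rewrite -natrM subr_gt0 ltr_nat; lia.
have cE : c = (2%:R * D - k%:R) / (D * (D - k%:R)).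
  by rewrite /c natrB ?(ltnW kD) //; field; rewrite !gt_eqF.
have c0 : 0 < c by rewrite cE divr_gt0 ?mulr_gt0.
have -> : n * D * (D - k%:R) / (2%:R * D - k%:R) = n / c.
  by rewrite cE; field; rewrite !gt_eqF.
(* The sum runs over arcs, so each edge counts twice; hence the factor 2 on both sides. *)
have : m * c * 2%:R <= n * 2%:R ?= iff
    [forall (p | p \in arcs G), maxn (deg p.1) (deg p.2) == max_deg G].
  have -> : m * c * 2%:R = \sum_(p in arcs G) c.
    by rewrite sumr_const card_arcs -[RHS]mulr_natr natrM mulrCA mulrA.
  rewrite [n * _]mulrC -sum_arcs_inv_deg //.
  apply: leif_sum => p; rewrite inE => xy.
  by apply: inv_sum_leif; rewrite ?dgt0 ?deg_le_max //; apply: stepwise_deg.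
case; rewrite ler_pM2r // -ler_pdivlMr // => le_m eq_m.
split=> //; rewrite -(degree_complexity_eq2 _ _ G_SI dgt0 n_gt0 k_ge1) -eq_m.
rewrite (inj_eq (mulIf _)) //.
have c_neq0 : c != 0 by rewrite gt_eqF.
by split=> [->|/eqP <-]; rewrite ?divfK ?mulfK.
Qed.
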